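(* Let $A$ be an integral domain with fraction field $\mathcal{K}(A)$, let $\mathcal{C}=A\cap\sum\mathcal{K}(A)^2$, and let $\operatorname{supp}$ be the support map sending a cone $P$ of $A$ to the ideal $\operatorname{supp}(P)=P\cap -P$ of $A$. Then: (1) The image under $\operatorname{supp}$ of the set of central cones of $A$ is the set of $\mathcal{C}$-convex ideals of $A$. (2) The image under $\operatorname{supp}$ of the set $\operatorname{Spec}_{pc}A$ of precentral orderings of $A$ is the set of central prime ideals of $A$.
   Context: All rings are commutative and contain $\mathbb{Q}$. $\sum\mathcal{K}(A)^2$ is the set of sums of squares of elements of $\mathcal{K}(A)$. A cone of a ring $B$ is a subset $P\subset B$ with $P+P\subset P$, $P\cdot P\subset P$ and $b^2\in P$ for all $b\in B$; it is proper if $-1\notin P$. A cone $P$ of $A$ is central if there is a cone $Q$ of $\mathcal{K}(A)$ with $Q\cap A\subset P$ (equivalently, $\mathcal{C}\subset P$). An ordering of $A$ is a proper cone $P$ such that $ab\in P$ implies $a\in P$ or $-b\in P$. A precentral ordering is an ordering which is a central cone. An ideal $I$ of $A$ is $\mathcal{C}$-convex if $p_1,p_2\in\mathcal{C}$ and $p_1+p_2\in I$ imply $p_1\in I$ and $p_2\in I$. An ideal $I$ of $A$ is central if $a\in A$, $p\in\mathcal{C}$ and $a^2+p\in I$ imply $a\in I$ (equivalently, $I$ is radical and $\mathcal{C}$-convex). *)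

(* Defs.v *)
From HB Require Import structures.
From mathcomp Require Import all_boot all_order all_algebra.
From mathcomp Require Import boolp classical_sets.

Set Implicit Arguments.
Unset Strict Implicit.
Unset Printing Implicit Defensive.

Import GRing.Theory.

Local Open Scope classical_set_scope.
Local Open Scope ring_scope.

Definition contains_rat (A : nzRingType) : Prop :=
  exists iota : {rmorphism rat -> A}, injective iota.

Section Ring.
Variable B : comNzRingType.
Implicit Types P I : set B.

Definition sums_of_squares : set B :=
  [set x | exists s : seq B, x = \sum_(y <- s) y ^+ 2].

Definition cone P : Prop :=
  [/\ forall a b, P a -> P b -> P (a + b),
      forall a b, P a -> P b -> P (a * b) &
      forall b, P (b ^+ 2)].

Definition proper_cone P : Prop := cone P /\ ~ P (-1).

Definition ordering P : Prop :=
  proper_cone P /\ forall a b, P (a * b) -> P a \/ P (- b).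

Definition supp P : set B := P `&` [set - p | p in P].

(* The library's [idealr_closed] excludes the unit ideal, which is the support
   of the improper cone and has to be allowed here. *)
Definition is_ideal I : Prop :=
  [/\ I 0,
      forall a b, I a -> I b -> I (a + b) &
      forall c a, I a -> I (c * a)].

Definition prime_ideal I : Prop :=
  [/\ is_ideal I, ~ I 1 & forall a b, I (a * b) -> I a \/ I b].

End Ring.

Arguments sums_of_squares : clear implicits.

Section Domain.
Variable A : idomainType.
Implicit Types P I : set A.

(* The intersection of a subset of the fraction field with A is its preimage
   under the embedding [tofrac]. *)
Definition restrict (Q : set {fraction A}) : set A := @tofrac A @^-1` Q.

Definition calC : set A := restrict (sums_of_squares {fraction A}).

Definition central_cone P : Prop :=
  cone P /\ exists2 Q : set {fraction A}, cone Q & restrict Q `<=` P.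

Definition precentral_ordering P : Prop := ordering P /\ central_cone P.

Definition convex_ideal I : Prop :=
  is_ideal I /\
  forall p1 p2, calC p1 -> calC p2 -> I (p1 + p2) -> I p1 /\ I p2.

Definition central_ideal I : Prop :=
  is_ideal I /\ forall a p, calC p -> I (a ^+ 2 + p) -> I a.

End Domain.

Arguments calC : clear implicits.

Definition Spec_pc (A : idomainType) : set (set A) :=
  [set P | precentral_ordering P].

Arguments Spec_pc : clear implicits.

(* Main.v *)
Require Import Defs.
From HB Require Import structures.
From mathcomp Require Import all_boot all_order all_algebra.
From mathcomp Require Import boolp classical_sets.
From mathcomp Require Import ring.

Set Implicit Arguments.
Unset Strict Implicit.
Unset Printing Implicit Defensive.

Import GRing.Theory.

Local Open Scope classical_set_scope.
Local Open Scope ring_scope.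

(** Write [C] for [calC A].  A cone of [A] is central exactly when it contains
    [C], because the sums of squares form the least cone of the fraction field.

    For (1), if [C] lies in a cone [P] and [p1 + p2] is in [supp P] with [p1],
    [p2] in [C], then [- p1 = - (p1 + p2) + p2] is in [P], so that [supp P] is
    convex.  Conversely, a convex ideal [I] is the support of the cone [I + C]:
    if [i + c] and [j + d] are opposite to each other, then [c + d] is in [I],
    hence so is [c] ([supp_ideal_plus_cone]).

    For (2), the support of an ordering is prime, and for prime ideals convexity
    and centrality agree.  Conversely, a central prime ideal [I] is convex, so
    it is the support of the central cone [I + C], and it remains to enlarge
    this cone to an ordering without enlarging its support
    ([cone_sub_ordering]).  Zorn's lemma gives a cone that is maximal among
    those with support [I].  Such a cone [P] is total: when [P + aP] has a
    larger support, there is [t] in [P], outside [I], with [- (a * t)] in [P],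
    that is, [a] is nonpositive in the fraction field of [A / I] for the order
    induced by [P]; if [P - aP] also has a larger support, then [a] is
    nonnegative there as well, and therefore lies in [I]
    ([adjoin_larger_supp], [maximal_cone_total]). *)

(** * Cones and their supports *)

Section ConeTheory.
Variable B : comNzRingType.
Implicit Types (P Q I : set B) (F : set (set B)).

Lemma suppE P a : supp P a <-> P a /\ P (- a).
Proof.
split=> [[Pa [p Pp Ep]]|[Pa PNa]]; first by rewrite -Ep opprK Ep.
by rewrite /supp; split=> //; exists (- a); rewrite ?opprK.
Qed.

Lemma cone0 P : cone P -> P 0.
Proof. by case=> _ _ /(_ 0); rewrite expr0n. Qed.

Lemma cone1 P : cone P -> P 1.
Proof. by case=> _ _ /(_ 1); rewrite expr1n. Qed.

Lemma cone_sums_of_squares : cone (sums_of_squares B).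
Proof.
split=> [a b [s ->] [t ->]|a b [s ->] [t ->]|b].
- by exists (s ++ t); rewrite big_cat.
- exists [seq x * y | x <- s, y <- t]; rewrite big_distrlr big_allpairs_dep /=.
  by under [RHS]eq_bigr do under eq_bigr do rewrite exprMn.
- by exists [:: b]; rewrite big_seq1.
Qed.

Lemma sums_of_squares_sub_cone P : cone P -> sums_of_squares B `<=` P.
Proof.
move=> cP _ [s ->]; have [PD _ Psq] := cP.
by elim/big_ind: _ => //; exact: cone0.
Qed.

Lemma is_ideal_opp I a : is_ideal I -> I a -> I (- a).
Proof. by case=> _ _ IM /(IM (-1)); rewrite mulN1r. Qed.

(** An element with a half is the difference of two squares,
    [c = ((c + 1) / 2) ^+ 2 - ((c - 1) / 2) ^+ 2], which makes the support
    stable under arbitrary multiplications. *)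
Lemma is_ideal_supp P (h : B) : h *+ 2 = 1 -> cone P -> is_ideal (supp P).
Proof.
move=> h2 cP; have [PD PM Psq] := cP; split.
- by apply/suppE; rewrite oppr0; split; exact: cone0.
- move=> a b /suppE[Pa PNa] /suppE[Pb PNb]; apply/suppE.
  by rewrite opprD; split; apply: PD.
- move=> c a /suppE[Pa PNa]; apply/suppE.
  have Ec : c = ((c + 1) * h) ^+ 2 - ((c - 1) * h) ^+ 2.
    transitivity (c * (h *+ 2) ^+ 2); first by rewrite h2 expr1n mulr1.
    by ring.
  set u := (c + 1) * h in Ec; set v := (c - 1) * h in Ec.
  have -> : c * a = u ^+ 2 * a + v ^+ 2 * - a by rewrite Ec; ring.
  have -> : - (u ^+ 2 * a + v ^+ 2 * - a) = u ^+ 2 * - a + v ^+ 2 * a by ring.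
  by split; apply: PD; apply: (PM).
Qed.

Lemma supp_convex P p q :
  cone P -> P p -> P q -> supp P (p + q) -> supp P p /\ supp P q.
Proof.
move=> [PD _ _] Pp Pq /suppE[_ PN]; split; apply/suppE; split=> //.
- by have := PD _ _ PN Pq; rewrite opprD addrNK.
- by have := PD _ _ PN Pp; rewrite opprD addrAC addNr add0r.
Qed.

Lemma prime_ideal_sqr I a : prime_ideal I -> I (a ^+ 2) -> I a.
Proof. by case=> _ _ + Iaa => /(_ a a Iaa) []. Qed.

Lemma ordering_total P a : ordering P -> P a \/ P (- a).
Proof. by case=> [[[_ _ Psq] _] Por]; apply: Por; exact: Psq. Qed.

(** If [a * b] is in the support, then each of the four products of [a] or
    [- a] by [b] or [- b] is in [P], and the defining property of an ordering
    applies to all of them. *)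
Lemma prime_ideal_supp P :
  is_ideal (supp P) -> ordering P -> prime_ideal (supp P).
Proof.
move=> iP [[cP PN1] Por]; split=> // [/suppE[]//|a b /suppE[Pab PNab]].
have P1 : P a \/ P (- b) by exact: Por.
have P2 : P (- a) \/ P (- b) by apply: Por; rewrite mulNr.
have P3 : P a \/ P b by have := Por a (- b); rewrite mulrN opprK; exact.
have P4 : P (- a) \/ P b.
  by have := Por (- a) (- b); rewrite mulrNN opprK; exact.
have [[Pa PNa]|nPa] := pselect (P a /\ P (- a)); first by left; apply/suppE.
by right; apply/suppE; tauto.
Qed.

Lemma ordering_of_total P :
  cone P -> prime_ideal (supp P) -> (forall a, P a \/ P (- a)) -> ordering P.
Proof.
move=> cP [_ nI1 Ior] Ptot; have [PD PM Psq] := cP.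
split; first by split=> // PN1; apply: nI1; apply/suppE; split=> //; exact: cone1.
move=> a b Pab; have [Pa|PNa] := Ptot a; first by left.
have [Pb|PNb] := Ptot b; last by right.
have /Ior[/suppE[]|/suppE[]] : supp P (a * b); [|by left|by right].
by apply/suppE; split=> //; rewrite -mulNr; exact: PM.
Qed.

(** * The cone spanned by an ideal and a cone *)

Definition ideal_plus I P : set B :=
  [set x | exists i c, [/\ I i, P c & x = i + c]].

Lemma cone_ideal_plus I P : is_ideal I -> cone P -> cone (ideal_plus I P).
Proof.
move=> [I0 ID IM] [PD PM Psq]; split.
- move=> _ _ [i [c [Ii Pc ->]]] [j [d [Ij Pd ->]]].
  by exists (i + j), (c + d); split; [exact: ID|exact: PD|rewrite addrACA].
- move=> _ _ [i [c [Ii Pc ->]]] [j [d [Ij Pd ->]]].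
  exists ((j + d) * i + c * j), (c * d); split; last by ring.
  + by apply: ID; exact: IM.
  + exact: PM.
- by move=> b; exists 0, (b ^+ 2); split=> //; rewrite add0r.
Qed.

Lemma sub_ideal_plus I P : is_ideal I -> P `<=` ideal_plus I P.
Proof. by move=> [I0 _ _] c Pc; exists 0, c; rewrite add0r. Qed.

Lemma supp_ideal_plus_cone I P : is_ideal I -> cone P ->
  (forall p q, P p -> P q -> I (p + q) -> I p /\ I q) ->
  supp (ideal_plus I P) = I.
Proof.
move=> iI cP Icvx; have [_ ID _] := iI.
apply/seteqP; split=> a.
- move=> /suppE[[i [c [Ii Pc ->]]] [j [d [Ij Pd ENa]]]].
  have [|Ic _] := Icvx _ _ Pc Pd; last exact: ID.
  have -> : c + d = - (i + j).
    by apply/eqP; rewrite -subr_eq0 -(addrN (i + c)) ENa; apply/eqP; ring.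
  by apply: is_ideal_opp => //; exact: ID.
- move=> Ia; apply/suppE; split.
  + by exists a, 0; split; [|exact: cone0|rewrite addr0].
  + by exists (- a), 0; split; [exact: is_ideal_opp|exact: cone0|rewrite addr0].
Qed.

(** * Enlarging a cone to an ordering with the same support *)

Definition adjoin P (a : B) : set B :=
  [set x | exists p q, [/\ P p, P q & x = p + a * q]].

Lemma cone_adjoin P a : cone P -> cone (adjoin P a).
Proof.
move=> cP; have [PD PM Psq] := cP; split.
- move=> _ _ [p [q [Pp Pq ->]]] [p' [q' [Pp' Pq' ->]]].
  by exists (p + p'), (q + q'); split; [exact: PD|exact: PD|ring].
- move=> _ _ [p [q [Pp Pq ->]]] [p' [q' [Pp' Pq' ->]]].
  exists (p * p' + a ^+ 2 * (q * q')), (p * q' + q * p').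
  by split; last (by ring); apply: PD; do ?[apply: (PM) => //].
- move=> b; exists (b ^+ 2), 0.
  by split=> //; [exact: cone0|rewrite mulr0 addr0].
Qed.

Lemma sub_adjoin P a : cone P -> P `<=` adjoin P a.
Proof.
by move=> cP p Pp; exists p, 0; split=> //; [exact: cone0|rewrite mulr0 addr0].
Qed.

Lemma adjoin_self P a : cone P -> adjoin P a a.
Proof.
move=> cP; exists 0, 1.
by split; [exact: cone0|exact: cone1|rewrite add0r mulr1].
Qed.

(** If [p + a * q] and [p' + a * q'] are opposite to each other and outside
    [supp P], then [t = q + q'] works, since [- (a * t) = p + p'].  Were [t] in
    the support, so would be [p + p'], and convexity of the support would put
    [p] and [q] there, hence also [p + a * q]. *)
Lemma adjoin_larger_supp P a : cone P -> is_ideal (supp P) ->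
  ~ (supp (adjoin P a) `<=` supp P) ->
  exists2 t, P t & ~ supp P t /\ P (- (a * t)).
Proof.
move=> cP iP /existsNP[x /not_implyP[]].
move=> /suppE[[p [q [Pp Pq ->]]] [p' [q' [Pp' Pq' E]]]] nx.
have [PD _ _] := cP; have [_ ID IM] := iP.
have Es : - (a * (q + q')) = p + p'.
  apply/eqP; rewrite eq_sym -subr_eq0 -(addrN (p + a * q)) E.
  by apply/eqP; ring.
exists (q + q'); first exact: PD.
split; last by rewrite Es; exact: PD.
move=> It; apply: nx.
have [Iq _] := supp_convex cP Pq Pq' It.
have [|Ip _] := supp_convex cP Pp Pp'; last by apply: ID => //; exact: IM.
by rewrite -Es; apply: is_ideal_opp => //; exact: IM.
Qed.

Lemma maximal_cone_total P a : cone P -> prime_ideal (supp P) ->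
  (forall Q, cone Q -> P `<=` Q -> supp Q `<=` supp P -> Q `<=` P) ->
  P a \/ P (- a).
Proof.
move=> cP [iP nI1 Ior] Pmax; have [PD PM _] := cP.
have adj b : supp (adjoin P b) `<=` supp P -> P b.
  move=> sI; apply: (Pmax _ (cone_adjoin b cP)) => //; first exact: sub_adjoin.
  exact: adjoin_self.
have [/adj|/(adjoin_larger_supp cP iP)[t Pt [nt Pat]]] :=
  pselect (supp (adjoin P a) `<=` supp P); first by left.
have [/adj|/(adjoin_larger_supp cP iP)[u Pu [nu Pau]]] :=
  pselect (supp (adjoin P (- a)) `<=` supp P); first by right.
left; rewrite mulNr opprK in Pau.
(* [a * t * u] is nonnegative through [a * u] and nonpositive through [a * t]. *)
have /Ior[/Ior[/suppE[]//|/nt]|/nu] // : supp P (a * t * u).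
apply/suppE; split; first by rewrite mulrAC; exact: PM.
by rewrite -mulNr; exact: PM.
Qed.

(** The empty set is added to the family to which Zorn's lemma is applied since
    it is the union of the empty chain. *)
Lemma maximal_cone P0 : cone P0 -> exists P,
  [/\ cone P, P0 `<=` P, supp P `<=` supp P0 &
      forall Q, cone Q -> P `<=` Q -> supp Q `<=` supp P -> Q `<=` P].
Proof.
move=> cP0.
pose good P := [/\ cone P, P0 `<=` P & supp P `<=` supp P0].
have [F Fgood Ftot|M [Mgood Mmax]] :=
  @Zorn_bigcup B [set P | P !=set0 -> good P].
  move=> [x0 [X0 FX0 X0x0]].
  have gd X x : F X -> X x -> good X by move=> FX Xx; apply: Fgood => //; exists x.
  have [cX0 sX0 _] := gd _ _ FX0 X0x0.
  have joint a b X Y : F X -> F Y -> X a -> Y b ->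
      exists Z, [/\ F Z, good Z, Z a & Z b].
    move=> FX FY Xa Yb; have [XY|YX] := Ftot _ _ FX FY.
    - by exists Y; split=> //; [exact: gd Yb|exact: XY].
    - by exists X; split=> //; [exact: gd Xa|exact: YX].
  split.
  - split=> [a b [X FX Xa] [Y FY Yb]|a b [X FX Xa] [Y FY Yb]|b].
    + have [Z [FZ [[ZD _ _] _ _] Za Zb]] := joint _ _ _ _ FX FY Xa Yb.
      by exists Z => //; exact: ZD.
    + have [Z [FZ [[_ ZM _] _ _] Za Zb]] := joint _ _ _ _ FX FY Xa Yb.
      by exists Z => //; exact: ZM.
    + by exists X0 => //; case: cX0.
  - by move=> x /sX0; exists X0.
  - move=> a /suppE[[X FX Xa] [Y FY Yb]].
    have [Z [FZ [_ _ ZI] Za Zb]] := joint _ _ _ _ FX FY Xa Yb.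
    by apply: ZI; apply/suppE.
have M0 : M !=set0.
  apply: contrapT => nM; apply: (Mmax P0) => [|_]; last by split.
  split=> [x Mx|s]; first by case: nM; exists x.
  by apply: nM; exists 0; apply: s; exact: cone0.
have [cM sM IM] := Mgood M0; exists M; split=> // Q cQ MQ IQ.
apply: contrapT => nQM; apply: (Mmax Q) => [//|_]; split=> //.
- exact: subset_trans MQ.
- exact: subset_trans IM.
Qed.

Lemma cone_sub_ordering P0 : cone P0 -> prime_ideal (supp P0) ->
  exists P, [/\ ordering P, P0 `<=` P & supp P = supp P0].
Proof.
move=> cP0 pI; have [P [cP sP IP Pmax]] := maximal_cone cP0.
have E : supp P = supp P0.
  apply/seteqP; split=> // a /suppE[P0a P0Na].
  by apply/suppE; split; exact: sP.
exists P; split=> //; apply: ordering_of_total; rewrite ?E// => a.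
by apply: maximal_cone_total; rewrite ?E// => Q cQ PQ; rewrite -E; exact: Pmax.
Qed.

End ConeTheory.

(** * Central cones and central ideals *)

Lemma contains_rat_half (A : nzRingType) :
  contains_rat A -> exists h : A, h *+ 2 = 1.
Proof.
case=> iota _; exists (iota 2%:R^-1).
have half : 2%:R^-1 *+ 2 = 1 :> rat by [].
by rewrite -raddfMn half; exact: rmorph1.
Qed.

Section CentralTheory.
Variable A : idomainType.
Implicit Types P I : set A.

Lemma cone_calC : cone (calC A).
Proof.
have [CD CM Csq] := cone_sums_of_squares {fraction A}.
rewrite /calC /restrict; split=> [a b|a b|b] /=.
- by rewrite rmorphD; exact: CD.
- by rewrite rmorphM; exact: CM.
- by rewrite rmorphXn; exact: Csq.
Qed.

Lemma central_coneP P : central_cone P <-> cone P /\ calC A `<=` P.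
Proof.
split=> [[cP [Q cQ QP]]|[cP CP]]; split=> //.
- by move=> a Ca; apply: QP; exact: sums_of_squares_sub_cone Ca.
- by exists (sums_of_squares {fraction A}) => //; exact: cone_sums_of_squares.
Qed.

Lemma convex_ideal_supp P :
  is_ideal (supp P) -> central_cone P -> convex_ideal (supp P).
Proof.
move=> iP /central_coneP[cP CP]; split=> // p q Cp Cq.
by apply: supp_convex => //; exact: CP.
Qed.

(** Multiplying [p + q] by [p] gives [p ^+ 2 + p * q], to which centrality
    applies because [p * q] is again in [calC A]. *)
Lemma central_convex_ideal I : central_ideal I -> convex_ideal I.
Proof.
move=> [iI Icent]; split=> //; have [_ _ IM] := iI; have [_ CM _] := cone_calC.
suff cvxl p q : calC A p -> calC A q -> I (p + q) -> I p.
  move=> p q Cp Cq Ipq; split; first exact: cvxl Ipq.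
  by move: Ipq; rewrite addrC; exact: cvxl.
move=> Cp Cq Ipq; apply: (Icent p (p * q)); first exact: CM.
by rewrite expr2 -mulrDr; exact: IM.
Qed.

Lemma convex_central_ideal I :
  prime_ideal I -> convex_ideal I -> central_ideal I.
Proof.
move=> pI [iI Icvx]; split=> // a p Cp Iap; have [_ _ Csq] := cone_calC.
by have [Iaa _] := Icvx _ _ (Csq a) Cp Iap; exact: prime_ideal_sqr.
Qed.

Lemma convex_ideal_central_cone I : convex_ideal I ->
  exists2 P, central_cone P & supp P = I.
Proof.
move=> [iI Icvx]; exists (ideal_plus I (calC A)).
- apply/central_coneP; split; first exact: cone_ideal_plus cone_calC.
  exact: sub_ideal_plus.
- exact: supp_ideal_plus_cone cone_calC Icvx.
Qed.

End CentralTheory.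

Theorem proposition3p8 (A : idomainType) (QA : contains_rat A) :
  (@supp A @` [set P | central_cone P] = [set I | convex_ideal I]) /\
  (@supp A @` Spec_pc A = [set I | prime_ideal I /\ central_ideal I]).
Proof.
have [h h2] := contains_rat_half QA; have isupp := is_ideal_supp h2.
split; apply/seteqP; split.
- move=> _ [P Pc <-]; have /central_coneP[cP _] := Pc.
  by apply: convex_ideal_supp => //; exact: isupp.
- exact: convex_ideal_central_cone.
- move=> _ [P [oP Pc] <-]; have /central_coneP[cP _] := Pc.
  have pI := prime_ideal_supp (isupp _ cP) oP.
  split=> //; apply: convex_central_ideal => //.
  by apply: convex_ideal_supp => //; exact: isupp.
- move=> I [pI /central_convex_ideal/convex_ideal_central_cone[P0 P0c E]].
  have /central_coneP[cP0 CP0] := P0c.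
  have [|P [oP sP EP]] := cone_sub_ordering cP0; first by rewrite E.
  exists P; last by rewrite EP.
  split=> //; apply/central_coneP; split; first by case: oP => [[]].
  exact: subset_trans sP.
Qed.
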